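(* Let $K$ be a field, $S=K[y_1,\dots,y_s]$, $d$ a positive integer, and $I\subset S$ a homogeneous ideal. Fix a weight vector $\omega\in\mathbb{N}^s$ of $S$ such that $\mathrm{in}_\omega(I)$ is a monomial ideal. Let $\{\mathbf{y}^{\mathbf{a}^{(1)}},\dots,\mathbf{y}^{\mathbf{a}^{(r)}}\}$, $\mathbf{a}^{(i)}=(a_{i1},\dots,a_{is})\in\mathbb{N}^s$, be the minimal system of generators of $\mathrm{in}_\omega(I)$, and set $$a=\max\{a_{ij}\mid 1\le i\le r,\ 1\le j\le s\}.$$ Let $\prec_{\Gamma_\omega}$ be the term order on $R^{[d]}$ constructed from the weight vector $\phi_d^*\omega$ with $\prec_\Gamma$ as a tie-breaker. If $d\ge s(a+1)/2$, then $\mathrm{in}_{\prec_{\Gamma_\omega}}(\phi_d^{-1}(I))$ is generated by quadratic monomials.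
   Context: ''Quadratic'' means ''of degree at most two''. $\mathbb{N}=\{0,1,2,\dots\}$; $\mathbb{N}^s_d=\{\mathbf{a}\in\mathbb{N}^s\mid a_1+\dots+a_s=d\}$. $R^{[d]}=K[x_{\mathbf{a}}\mid\mathbf{a}\in\mathbb{N}^s_d]$ is a polynomial ring, and $\phi_d:R^{[d]}\to S$ is the $K$-algebra homomorphism with $\phi_d(x_{\mathbf{a}})=\mathbf{y}^{\mathbf{a}}=y_1^{a_1}\cdots y_s^{a_s}$. Weights: for a weight vector $\omega$ with entries in $\mathbb{N}$ (one per variable), the monomial with exponent vector $\mathbf{a}$ has weight $\omega\cdot\mathbf{a}$; the initial form $\mathrm{in}_\omega(f)$ of a polynomial $f$ is the sum of all terms of $f$ of highest weight, and $\mathrm{in}_\omega(I)=\langle\mathrm{in}_\omega(f)\mid f\in I\rangle$. $\phi_d^*\omega$ is the weight vector on $R^{[d]}$ assigning weight $\omega\cdot\mathbf{a}$ to $x_{\mathbf{a}}$, $\mathbf{a}\in\mathbb{N}^s_d$. The term order constructed from a weight vector $\eta$ with a term order $\prec$ as tie-breaker declares a monomial $u$ smaller than $v$ if the $\eta$-weight of $u$ is less than that of $v$, or the weights are equal and $u\prec v$. Lexicographic order on $\mathbb{N}^s$: $\mathbf{a}\prec_{lex}\mathbf{b}$ if $a_j<b_j$ where $j=\min\{i\mid a_i\ne b_i\}$. Reverse lexicographic order: given a total order on the variables of a polynomial ring, for monomials $u,v$ one sets $u\prec v$ if $\deg u<\deg v$, or $\deg u=\deg v$ and the smallest variable having different exponents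 in $u$ and $v$ has a strictly larger exponent in $u$ than in $v$. For $\mathbf{a}\in\mathbb{N}^s$, $\Gamma(\mathbf{a})\in\mathbb{N}^s$ is the vector obtained by rearranging the entries of $\mathbf{a}$ in weakly increasing order. $\prec_\Gamma$ is the reverse lexicographic order on $R^{[d]}$ for the following order on the variables: $x_{\mathbf{a}}\prec_\Gamma x_{\mathbf{b}}$ if $\Gamma(\mathbf{b})\prec_{lex}\Gamma(\mathbf{a})$, or $\Gamma(\mathbf{b})=\Gamma(\mathbf{a})$ and $\mathbf{b}\prec_{lex}\mathbf{a}$. *)

(* Defs.v *)
From HB Require Import structures.
From mathcomp Require Import all_boot all_order all_algebra.
From mathcomp.multinomials Require Import mpoly.

Set Implicit Arguments.
Unset Strict Implicit.
Unset Printing Implicit Defensive.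

Import GRing.Theory.
Local Open Scope ring_scope.

(* Ideals are Prop-valued predicates: no membership test is assumed. *)
Section Ideals.
Variable A : comNzRingType.

Record is_ideal (I : A -> Prop) : Prop := IsIdeal {
  ideal_has0 : I 0;
  ideal_add : forall f g, I f -> I g -> I (f + g);
  ideal_mul : forall a f, I f -> I (a * f)
}.

Definition ideal_gen (G : A -> Prop) (f : A) : Prop :=
  exists r : seq (A * A),
    (forall p, p \in r -> G p.2) /\ f = \sum_(p <- r) p.1 * p.2.

Definition ideal_eq (I J : A -> Prop) : Prop := forall f, I f <-> J f.
End Ideals.

Section MonomialIdeals.
Variables (K : fieldType) (n : nat).
Implicit Types (I J : {mpoly K[n]} -> Prop) (M : 'X_{1..n} -> Prop).

Definition homogeneous_ideal I : Prop :=
  is_ideal I /\ forall f k, I f -> I (pihomog mdeg k f).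

Definition monomials_of M (f : {mpoly K[n]}) : Prop :=
  exists2 m, M m & f = 'X_[m].

Definition monomial_ideal J : Prop :=
  exists M, ideal_eq J (ideal_gen (monomials_of M)).

Definition generated_by_quadratic_monomials J : Prop :=
  exists M, (forall m, M m -> (mdeg m <= 2)%N) /\
    ideal_eq J (ideal_gen (monomials_of M)).

Definition minimal_monomial_generators J (G : seq 'X_{1..n}) : Prop :=
  [/\ uniq G,
      ideal_eq J (ideal_gen (monomials_of (fun m => m \in G)))
    & forall m, m \in G ->
        ~ ideal_eq J (ideal_gen (monomials_of (fun m' => m' \in rem m G)))].
End MonomialIdeals.

Section Weights.
Variables (n : nat) (w : 'I_n -> nat).

Definition wdeg (m : 'X_{1..n}) : nat := (\sum_(i < n) w i * m i)%N.

Lemma wdeg0 : wdeg 0%MM = 0%N.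
Proof. by rewrite /wdeg big1 // => i _; rewrite mnm0E muln0. Qed.

Lemma wdegD : {morph wdeg : m1 m2 / (m1 + m2)%MM >-> (m1 + m2)%N}.
Proof.
move=> m1 m2; rewrite /wdeg -big_split /=.
by apply: eq_bigr => i _; rewrite mnmDE mulnDr.
Qed.

HB.instance Definition _ := isMeasure.Build n wdeg wdeg0 wdegD.

(* For f != 0, (mmeasure wdeg f).-1 is the largest weight of a term of f. *)
Definition weight_initial_form (K : fieldType) (f : {mpoly K[n]}) :
    {mpoly K[n]} :=
  pihomog wdeg (mmeasure wdeg f).-1 f.

Definition weight_initial_ideal (K : fieldType) (I : {mpoly K[n]} -> Prop) :
    {mpoly K[n]} -> Prop :=
  ideal_gen (fun g => exists2 f, I f & g = weight_initial_form f).

Definition weight_order (tie : rel 'X_{1..n}) : rel 'X_{1..n} := fun u v =>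
  (wdeg u < wdeg v)%N || ((wdeg u == wdeg v) && tie u v).
End Weights.

Section TermOrders.
Variable n : nat.

Definition lex_lt (a b : 'X_{1..n}) : bool :=
  [exists j : 'I_n,
     (a j < b j)%N && [forall i : 'I_n, (i < j)%N ==> (a i == b i)]].

Definition revlex_lt (vlt : rel 'I_n) (u v : 'X_{1..n}) : bool :=
  (mdeg u < mdeg v)%N ||
  ((mdeg u == mdeg v) &&
   [exists i : 'I_n,
      (v i < u i)%N && [forall j : 'I_n, vlt j i ==> (u j == v j)]]).

Variable (K : fieldType).

Definition is_initial_term (lt : rel 'X_{1..n}) (f t : {mpoly K[n]}) : Prop :=
  exists m, [/\ m \in msupp f,
    forall m', m' \in msupp f -> m' != m -> lt m' m & t = f@_m *: 'X_[m]].

Definition initial_ideal (lt : rel 'X_{1..n}) (J : {mpoly K[n]} -> Prop) :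
    {mpoly K[n]} -> Prop :=
  ideal_gen (fun t => exists2 f, J f & is_initial_term lt f t).
End TermOrders.

Section Veronese.
Variables s d : nat.

(* The exponent vectors in N^s of total degree d; the variables of R^{[d]},
   indexed by 'I_#|degree_exps|, correspond to them through var_exp. *)
Definition degree_exps : {set 'X_{1..s < d.+1}} :=
  [set a : 'X_{1..s < d.+1} | mdeg a == d].

Definition var_exp (i : 'I_#|degree_exps|) : 'X_{1..s} := bmnm (enum_val i).

Definition veronese_map (K : fieldType) (f : {mpoly K[#|degree_exps|]}) :
    {mpoly K[s]} :=
  f \mPo [tuple 'X_[var_exp i] | i < #|degree_exps|].

Definition pullback_weight (w : 'I_s -> nat) : 'I_#|degree_exps| -> nat :=
  fun i => wdeg w (var_exp i).

Definition Gamma (a : 'X_{1..s}) : 'X_{1..s} :=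
  [multinom of sort leq (multinom_val a)].

Definition Gamma_var_lt : rel 'I_#|degree_exps| := fun i j =>
  lex_lt (Gamma (var_exp j)) (Gamma (var_exp i)) ||
  ((Gamma (var_exp j) == Gamma (var_exp i)) &&
   lex_lt (var_exp j) (var_exp i)).

Definition Gamma_lt : rel 'X_{1..#|degree_exps|} := revlex_lt Gamma_var_lt.

Definition Gamma_weight_lt (w : 'I_s -> nat) : rel 'X_{1..#|degree_exps|} :=
  weight_order (pullback_weight w) Gamma_lt.
End Veronese.

(* Main.v *)
(* Let [v] be a monomial of R^[d] and [b] the exponent of phi_d(v). If [v] leads
   an element of phi_d^-1(I), then either [v] is not the smallest monomial of its
   phi_d-fibre, or y^b lies in in_w(I); conversely both properties put [v] in the
   initial ideal, by a binomial in the first case and by lifting an element of I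
   with initial form y^b in the second. So it suffices to find a divisor of [v]
   of degree at most two with one of the two properties.

   Let x_c be the smallest variable of [v]. If every quadratic divisor of [v] is
   the smallest in its fibre, moving one unit between c and another factor shows
   that c_l <= c_j + [l < j] for all l and all j in the support of the other
   factors. A vector with this local property is optimal for the order of the
   variables, which settles the first case. In the second case the same
   inequalities give d < s (c_j + 1), hence a <= 2 c_j; adding them for the two
   smallest variables shows that their product is already mapped to a multiple
   of the generator dividing y^b. *)
Require Import Defs.
From mathcomp Require Import all_boot all_order all_algebra.
From mathcomp Require Import perm zify.
From mathcomp.multinomials Require Import mpoly.

Set Implicit Arguments.
Unset Strict Implicit.
Unset Printing Implicit Defensive.

Import Order.TTheory GRing.Theory.

(** * The order on the variables *)

Section LexOrder.
Variable n : nat.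
Implicit Types a b c : 'X_{1..n}.

Lemma lex_ltP a b : reflect
  (exists2 j : 'I_n, a j < b j & forall i : 'I_n, i < j -> a i = b i)
  (lex_lt a b).
Proof.
apply: (iffP existsP) => [[j /andP[ltj /forallP eqj]]|[j ltj eqj]]; exists j => //.
  by move=> i /(implyP (eqj i))/eqP.
by rewrite ltj; apply/forallP => i; apply/implyP => /eqj/eqP.
Qed.

Lemma lex_ltE a b : lex_lt a b =
  ((multinom_val a : n.-tuplelexi nat) < multinom_val b)%O.
Proof.
apply/lex_ltP/ltxi_tuplePlt => [[j ltj eqj]|[j eqj ltj]]; exists j => //.
Qed.

Lemma lex_lt_irr : irreflexive (@lex_lt n).
Proof. by move=> a; rewrite lex_ltE ltxx. Qed.

Lemma lex_lt_trans : transitive (@lex_lt n).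
Proof. by move=> b a c; rewrite !lex_ltE; apply: lt_trans. Qed.

Lemma lex_lt_total a b : a != b -> lex_lt a b || lex_lt b a.
Proof.
move=> neq_ab; rewrite !lex_ltE -neq_lt.
by apply: contraNneq neq_ab => /val_inj ->.
Qed.

(** These counts stand in for the sorted vector [Gamma a]: they determine it and are plain sums over
    the coordinates. *)
Definition count_below a t := \sum_(i < n) (a i < t).

Lemma count_belowE a t : count_below a t = count (fun x => x < t) (multinom_val a).
Proof.
by rewrite -sum1_count big_mkcond big_tuple; apply: eq_bigr => i _; case: ltnP.
Qed.

End LexOrder.

(** In a weakly increasing list the entries below [t] form an initial segment. *)
Lemma sorted_nth_ltn (s : seq nat) i t : sorted leq s -> i < size s ->
  (nth 0 s i < t) = (i < count (fun x => x < t) s).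
Proof.
elim: s i => //= x s IHs i xs lti.
have ss := path_sorted xs.
have [xt|tx] := ltnP x t.
  by case: i lti => [|i] lti /=; rewrite ?xt // add1n ltnS IHs.
rewrite add0n; have -> : count (fun x => x < t) s = 0.
  apply/eqP; rewrite -leqn0 leqNgt -has_count -all_predC; apply/allP => y ys /=.
  by rewrite -leqNgt (leq_trans tx) //; move/(order_path_min leq_trans)/allP: xs; apply.
case: i lti => [|i] lti /=; first by rewrite ltnNge tx.
apply/negbTE; rewrite -leqNgt (leq_trans tx) //.
by move/(order_path_min leq_trans)/allP: xs; apply; apply: mem_nth.
Qed.

(** * Counting functions, unit transfers and local optimality *)

Section GammaOrder.
Variable n : nat.
Implicit Types a b c : 'X_{1..n}.

Lemma Gamma_ltn a (i : 'I_n) t : (Gamma a i < t) = (i < count_below a t).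
Proof.
have -> : Gamma a i = nth 0 (sort leq (multinom_val a)) i.
  by rewrite /Gamma /fun_of_multinom /= (tnth_nth 0).
rewrite sorted_nth_ltn ?size_sort ?size_tuple ?(sort_sorted leq_total) //.
by rewrite count_sort -count_belowE.
Qed.

Lemma count_below_le a t : count_below a t <= n.
Proof. by rewrite count_belowE (leq_trans (count_size _ _)) ?size_tuple. Qed.

(** Sorted vector and counting function determine each other like conjugate partitions: the first
    position of difference becomes a first threshold, with the inequality reversed. *)
Lemma Gamma_lex_ltP a b : reflect
  (exists2 t, count_below a t < count_below b t
     & forall t', t' < t -> count_below a t' = count_below b t')
  (lex_lt (Gamma b) (Gamma a)).
Proof.
apply: (iffP (lex_ltP _ _)) => [[j ltj eqj]|[t ltt eqt]].
  exists (Gamma b j).+1 => [|t'].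
    apply: (@leq_ltn_trans j); last by rewrite -Gamma_ltn.
    by rewrite leqNgt -Gamma_ltn -leqNgt.
  rewrite ltnS => let'.
  have hb : count_below b t' <= j by rewrite leqNgt -Gamma_ltn -leqNgt.
  have ha : count_below a t' <= j.
    by rewrite leqNgt -Gamma_ltn -leqNgt (leq_trans let') // ltnW.
  have H k (kj : k < j) : (k < count_below a t') = (k < count_below b t').
    have kn := ltn_trans kj (ltn_ord j).
    by rewrite -(Gamma_ltn a (Ordinal kn)) -(Gamma_ltn b (Ordinal kn)) eqj.
  case: (ltngtP (count_below a t') (count_below b t')) => // lt_ab.
    by have := H _ (leq_trans lt_ab hb); rewrite lt_ab ltnn.
  by have := H _ (leq_trans lt_ab ha); rewrite lt_ab ltnn.
have jn : count_below a t < n := leq_trans ltt (count_below_le b t).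
exists (Ordinal jn) => [|i /= ij].
  by rewrite (@leq_trans t) ?Gamma_ltn // leqNgt Gamma_ltn ltnn.
have ha : Gamma a i < t by rewrite Gamma_ltn.
have hb : Gamma b i < t by rewrite Gamma_ltn (ltn_trans ij).
case: (ltngtP (Gamma b i) (Gamma a i)) => //.
  by rewrite Gamma_ltn -eqt // -Gamma_ltn ltnn.
by rewrite Gamma_ltn eqt // -Gamma_ltn ltnn.
Qed.

Lemma Gamma_eqP a b : Gamma a = Gamma b <-> count_below a =1 count_below b.
Proof.
split=> [eqG t|eqc].
  have H k (kn : k < n) : (k < count_below a t) = (k < count_below b t).
    by rewrite -(Gamma_ltn a (Ordinal kn)) -(Gamma_ltn b (Ordinal kn)) eqG.
  case: (ltngtP (count_below a t) (count_below b t)) => // lt_ab.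
    by have := H _ (leq_trans lt_ab (count_below_le _ _)); rewrite lt_ab ltnn.
  by have := H _ (leq_trans lt_ab (count_below_le _ _)); rewrite lt_ab ltnn.
apply/eqP; apply: contraT => /lex_lt_total/orP[] /Gamma_lex_ltP[t];
  by rewrite eqc ltnn.
Qed.

(* [x_a] is smaller than [x_b] for the order on the variables. *)
Definition gamma_lt a b :=
  lex_lt (Gamma b) (Gamma a) || ((Gamma b == Gamma a) && lex_lt b a).

Lemma gamma_lt_irr : irreflexive gamma_lt.
Proof. by move=> a; rewrite /gamma_lt !lex_lt_irr andbF. Qed.

Lemma gamma_lt_trans : transitive gamma_lt.
Proof.
move=> b a c /orP[ba|/andP[/eqP eqba ba]] /orP[cb|/andP[/eqP eqcb cb]].
- by rewrite /gamma_lt (lex_lt_trans cb ba).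
- by rewrite /gamma_lt eqcb ba.
- by rewrite /gamma_lt -eqba cb.
- by rewrite /gamma_lt eqcb eqba eqxx (lex_lt_trans cb ba) orbT.
Qed.

Lemma gamma_lt_total a b : a != b -> gamma_lt a b || gamma_lt b a.
Proof.
move=> neq_ab; rewrite /gamma_lt.
have [eqG|neqG] := eqVneq (Gamma b) (Gamma a).
  by rewrite eqG ?eqxx lex_lt_irr orbC lex_lt_total.
by have /orP[->|->] := lex_lt_total neqG; rewrite ?orbT.
Qed.

Definition transfer c (j l : 'I_n) : 'X_{1..n} := (c + U_(j) - U_(l))%MM.

Lemma transferE c j l i : transfer c j l i = c i + (j == i) - (l == i).
Proof. by rewrite mnmBE mnmDE !mnm1E. Qed.

(** By [transfer_lt], failure at [l] means that moving a unit from [l] to [j] gives a smaller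
    variable. The term [l < j] is the tie-break: if [c l = c j + 1], the move swaps two entries, an
    improvement only for [j < l]. *)
Definition locally_balanced c (j : 'I_n) :=
  [forall l : 'I_n, c l <= c j + (l < j)].

(** A gap of at least two leaves fewer entries below [c j + 1] and changes no lower count. A gap of
    one forces [j < l]; the move is then a transposition, and the lexicographic tie-break
    decides. *)
Lemma transfer_lt c (j l : 'I_n) : c j + (l < j) < c l -> gamma_lt (transfer c j l) c.
Proof.
move=> ltjl; have neqjl : j != l by apply: contraTneq ltjl => ->; lia.
have neqlj : l != j by rewrite eq_sym.
have [gap|] := ltnP (c j).+1 (c l).
  apply/orP; left; apply/Gamma_lex_ltP; exists (c j).+1 => [|t lt_t].
    rewrite /count_below !(bigD1 j (P := predT)) //= transferE eqxx (negbTE neqlj).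
    rewrite addn1 subn0 ltnn ltnSn add0n ltnS; apply: leq_sum => i neqij.
    rewrite transferE (eq_sym j) (negbTE neqij); case: eqVneq => [<-|_]; lia.
  apply: eq_bigr => i _; rewrite transferE.
  case: (eqVneq j i) => [<-|_]; rewrite ?(negbTE neqlj); first lia.
  case: eqVneq => [<-|_]; lia.
move=> gap; have eqc : c l = (c j).+1 by lia.
have ltjl' : j < l by move: neqjl; rewrite -val_eqE /=; lia.
have eqT i : transfer c j l i = c (tperm j l i).
  rewrite transferE; case: tpermP => [->|->|/eqP ij /eqP il].
  - by rewrite eqxx (negbTE neqlj); lia.
  - by rewrite eqxx (negbTE neqjl); lia.
  - by rewrite (eq_sym j) (eq_sym l) (negbTE ij) (negbTE il); lia.
apply/orP; right; apply/andP; split.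
  apply/eqP/Gamma_eqP => t; rewrite /count_below
     [LHS](reindex_inj (@perm_inj _ (tperm j l))).
  by apply: eq_bigr => i _; rewrite eqT.
apply/lex_ltP; exists j => [|i ltij]; first by rewrite eqT tpermL eqc.
rewrite eqT tpermD // -val_eqE /=; lia.
Qed.

Lemma leq_sum_eq (F F' : 'I_n -> nat) :
    (forall i, F i <= F' i) -> \sum_i F' i <= \sum_i F i ->
  forall i, F i = F' i.
Proof.
move=> leF leS i; apply/eqP; rewrite eqn_leq leF leqNgt; apply/negP => ltF.
suff : \sum_i F i < \sum_i F' i by rewrite ltnNge leS.
by rewrite !(bigD1 i (P := predT)) //= -addSn leq_add // leq_sum.
Qed.

(* Local optimality implies global optimality, as for separable convex
   functions on the integer points of a base polytope. *)
Lemma locally_balanced_min (P : pred 'I_n) c c' :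
    (forall j, P j -> locally_balanced c j) ->
    (forall i, ~~ P i -> c' i <= c i) -> mdeg c' = mdeg c ->
  ~~ gamma_lt c' c.
Proof.
move=> balP leP eqdeg; pose m := \max_(i < n) c i.
have lem i : c i <= m by apply: leq_bigmax.
(* Only coordinates in [P] may increase, and these are within one of the maximum. *)
have gem j : P j -> m <= (c j).+1.
  move=> Pj; apply/bigmax_leqP => l _; have /forallP/(_ l) := balP j Pj; lia.
have sumE : \sum_i c' i = \sum_i c i by rewrite -!mdegE.
have raised i : c i < c' i -> P i by apply: contraTT => /leP; rewrite -leqNgt.
have below t i : t < m -> (c i < t) <= (c' i < t).
  move=> ltm; case: ltnP => // lt_ct; suff : c' i <= c i by lia.
  by apply: leP; apply/negP => /gem; lia.
(* If the counts agree below [m], so do the two vectors truncated at [m - 1]. As [c i <= m], the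
   inequality follows, strict exactly when [c' i > m]. *)
have shift : (forall t, t < m -> count_below c' t = count_below c t) ->
    forall i, c i + (m <= c' i) <= c' i + (m <= c i).
  move=> eqc i; have eqt t : t < m -> (c i < t) = (c' i < t) :> nat.
    move=> ltm; apply: (@leq_sum_eq (fun i => c i < t : nat) (fun i => c' i < t : nat)).
      by move=> k; apply: below.
    by rewrite -/(count_below c' t) eqc.
  have {}eqt t : t < m -> (c i < t) = (c' i < t).
    by move=> /eqt; case: (c i < t); case: (c' i < t).
  have [lt_cm|le_mc] := ltnP (c i).+1 m.
    have := eqt _ lt_cm; have := eqt _ (ltnW lt_cm); rewrite ltnn ltnSn; lia.
  have [m0|m_gt0] := posnP m; first by rewrite m0 leq0n; have := lem i; lia.
  have := lem i; have := @eqt m.-1; rewrite prednK // leqnn => /(_ isT); lia.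
have sum_ge b : \sum_i (m <= b i) = n - count_below b m.
  apply/esym/(canLR (addnK _)); rewrite -big_split /= -[LHS]card_ord -sum1_card.
  by apply: eq_bigr => i _; case: leqP.
(* Agreement at [m] as well makes the two sums equal, so no entry of [c'] exceeds [m]. *)
have shift_eq : (forall t, t <= m -> count_below c' t = count_below c t) ->
    forall i, c i + (m <= c' i) = c' i + (m <= c i).
  move=> eqc; apply: leq_sum_eq; first by apply: shift => t /ltnW/eqc.
  by rewrite !big_split /= sumE !sum_ge eqc.
apply/norP; split.
  apply/Gamma_lex_ltP => -[t ltt eqt].
  have [lt_tm|le_mt] := ltnP t m.
    by move: ltt; rewrite ltnNge leq_sum // => i _; apply: below.
  have sh := shift (fun t' lt' => eqt t' (leq_trans lt' le_mt)).
  (* Summation gives [count_below c m <= count_below c' m], which excludes [t = m]. *)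
  have : \sum_i (c i + (m <= c' i)) <= \sum_i (c' i + (m <= c i)) by apply: leq_sum.
  rewrite !big_split /= sumE leq_add2l !sum_ge.
  have := count_below_le c m; have := count_below_le c' m.
  have [->|neq_tm] := eqVneq m t; first lia.
  move=> _ _ _; have lt_mt : m < t by rewrite ltn_neqAle neq_tm.
  have sheq := shift_eq (fun t' lt' => eqt t' (leq_ltn_trans lt' lt_mt)).
  move: ltt; rewrite ltnNge leq_sum // => i _.
  by have := sheq i; have := lem i; lia.
apply/negP => /andP[/eqP/esym/Gamma_eqP eqc /lex_ltP[i lti eqi]].
have sheq := shift_eq (fun t _ => eqc t).
(* Entry [i] rises from [m - 1] to [m]. By balance at [i], later entries of [c] are at most
   [c i < m], so they cannot drop, against equal degrees. *)
suff : \sum_i c i < \sum_i c' i by rewrite sumE ltnn.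
rewrite !(bigD1 i (P := predT)) //= -addSn leq_add // leq_sum // => l neqli.
have [/eqi ->//|leil] := ltnP l i.
have /forallP/(_ l) := balP i (raised i lti).
by have := sheq i; have := sheq l; have := lem i; lia.
Qed.

(** Every entry is at most [c j + 1], strictly less at [j] itself, so [d < n * (c j + 1)]. *)
Lemma locally_balanced_half c d (a : nat) j :
    mdeg c = d -> n * (a + 1) <= 2 * d -> locally_balanced c j ->
  a <= 2 * c j.
Proof.
move=> <- le_ad /forallP bal.
suff : mdeg c < n * (c j).+1 by move: (ltn_ord j); nia.
have -> : n * (c j).+1 = \sum_(i < n) (c j).+1 by rewrite sum_nat_const card_ord.
rewrite mdegE !(bigD1 j (P := predT)) //= -addSn leq_add // leq_sum // => l _.
by have := bal l; lia.
Qed.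
End GammaOrder.

(** * Quadratic divisors of monomials *)

Section VeroneseMonomials.
Variables s d : nat.
Local Notation N := #|degree_exps s d|.
Implicit Types (m v : 'X_{1..N}) (p q r : 'I_N) (b : 'X_{1..s}).

Lemma mdeg_var_exp p : mdeg (var_exp p) = d.
Proof. by have := enum_valP p; rewrite inE => /eqP. Qed.

Lemma var_exp_inj : injective (@var_exp s d).
Proof. by move=> p q /val_inj/enum_val_inj. Qed.

Lemma var_exp_surj b : mdeg b = d -> exists p, var_exp p = b.
Proof.
move=> degb; have ltb : mdeg b < d.+1 by rewrite degb.
have bP : BMultinom ltb \in degree_exps s d by rewrite inE /= degb.
by exists (enum_rank_in bP (BMultinom ltb)); rewrite /var_exp enum_rankK_in.
Qed.

Lemma Gamma_var_ltE p q : Gamma_var_lt p q = gamma_lt (var_exp p) (var_exp q).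
Proof. by []. Qed.

Lemma Gamma_var_lt_irr : irreflexive (@Gamma_var_lt s d).
Proof. by move=> p; rewrite Gamma_var_ltE gamma_lt_irr. Qed.

Lemma Gamma_var_lt_trans : transitive (@Gamma_var_lt s d).
Proof. by move=> q p r; apply: gamma_lt_trans. Qed.

Lemma Gamma_var_lt_total p q : p != q -> Gamma_var_lt p q || Gamma_var_lt q p.
Proof. by move=> neq_pq; apply: gamma_lt_total; rewrite (inj_eq var_exp_inj). Qed.

Lemma Gamma_var_min (P : pred 'I_N) p0 : P p0 ->
  exists2 p, P p & forall q, P q -> ~~ Gamma_var_lt q p.
Proof.
move=> Pp0; pose rank p := #|[pred q | Gamma_var_lt q p]|.
have [p Pp minp] := arg_minnP rank Pp0; exists p => // q /minp; rewrite leqNgt.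
apply: contra => lt_qp; apply: proper_card; apply/properP; split.
  by apply/subsetP => x; rewrite !inE => /Gamma_var_lt_trans; apply.
by exists q; rewrite !inE ?Gamma_var_lt_irr.
Qed.

(** The exponent of the image of the monomial [m] under phi_d, see [veronese_mapX]. *)
Definition veronese_exp m : 'X_{1..s} := (\sum_p var_exp p *+ m p)%MM.

Lemma veronese_expE m j : veronese_exp m j = \sum_p var_exp p j * m p.
Proof. by rewrite mnm_sumE; apply: eq_bigr => p _; rewrite mulmnE. Qed.

Lemma veronese_expD m1 m2 :
  veronese_exp (m1 + m2) = (veronese_exp m1 + veronese_exp m2)%MM.
Proof.
apply/mnmP => j; rewrite mnmDE !veronese_expE -big_split /=.
by apply: eq_bigr => p _; rewrite mnmDE mulnDr.
Qed.

Lemma veronese_exp1 p : veronese_exp U_(p) = var_exp p.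
Proof.
apply/mnmP => j; rewrite veronese_expE (bigD1 p) //= mnm1E eqxx muln1.
by rewrite big1 ?addn0 // => q neq_qp; rewrite mnm1E eq_sym (negbTE neq_qp) muln0.
Qed.

Lemma mdeg_veronese_exp m : mdeg (veronese_exp m) = d * mdeg m.
Proof.
rewrite mdeg_sum mdegE big_distrr /=; apply: eq_bigr => p _.
by rewrite mdegMn mdeg_var_exp.
Qed.

Lemma veronese_exp_gt0 m j : 0 < veronese_exp m j ->
  exists2 p, 0 < m p & 0 < var_exp p j.
Proof.
rewrite veronese_expE lt0n sum_nat_eq0 negb_forall => /existsP[p].
by rewrite /= muln_eq0 negb_or -!lt0n => /andP[]; exists p.
Qed.

Lemma wdeg_veronese_exp (w : 'I_s -> nat) m :
  wdeg (@pullback_weight s d w) m = wdeg w (veronese_exp m).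
Proof.
rewrite /wdeg; under [RHS]eq_bigr => i _ do rewrite veronese_expE big_distrr /=.
rewrite exchange_big /=; apply: eq_bigr => p _; rewrite /pullback_weight /wdeg.
by rewrite big_distrl /=; apply: eq_bigr => i _; rewrite mulnA.
Qed.

Lemma sub_mnm_mdeg b k : k <= mdeg b -> exists2 c, (c <= b)%MM & mdeg c = k.
Proof.
elim: k => [_|k IHk ltk].
  by exists 0%MM; rewrite ?mdeg0 //; apply/mnm_lepP => i; rewrite mnm0E.
have [c /mnm_lepP lecb degc] := IHk (ltnW ltk).
have [i lti] : exists i, c i < b i.
  apply/existsP; rewrite -[X in is_true X]negbK negb_exists; apply/negP => /forallP leb.
  move: ltk; rewrite -degc !mdegE ltnNge leq_sum // => i _.
  by rewrite leqNgt leb.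
exists (c + U_(i))%MM; last by rewrite mdegD mdeg1 degc addn1.
apply/mnm_lepP => l; rewrite mnmDE mnm1E; case: eqVneq => [<-|_]; rewrite ?addn1 //.
by rewrite addn0.
Qed.

Lemma veronese_exp_surj k b : mdeg b = d * k -> exists m, veronese_exp m = b.
Proof.
elim: k b => [|k IHk] b degb.
  have -> : b = 0%MM by apply/eqP; rewrite -mdeg_eq0 degb muln0.
  by exists 0%MM; apply/mnmP => j; rewrite veronese_expE big1 => [|p _]; rewrite mnm0E ?muln0.
have [c lecb degc] : exists2 c, (c <= b)%MM & mdeg c = d.
  by apply: sub_mnm_mdeg; rewrite degb leq_pmulr.
have [p vp] := var_exp_surj degc.
have degbc : mdeg (b - c) = d * k.
  by move: degb; rewrite -{1}(submK lecb) mdegD degc mulnS addnC => /addnI.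
have [m vm] := IHk _ degbc.
by exists (m + U_(p))%MM; rewrite veronese_expD veronese_exp1 vp vm submK.
Qed.

(* [v] is a non-standard monomial for the toric ideal, the kernel of the
   Veronese map. *)
Definition toric_initial v :=
  exists2 v', Gamma_lt v' v & veronese_exp v' = veronese_exp v.

(** Moving a unit from [l] to [j] in [x_p] and back in [x_q] keeps the image of the product and
    replaces [x_p], a smallest factor, by a smaller variable. *)
Lemma toric_initial_transfer p q (j l : 'I_s) :
    ~~ Gamma_var_lt q p -> 0 < var_exp q j ->
    var_exp p j + (l < j) < var_exp p l -> toric_initial (U_(p) + U_(q)).
Proof.
move=> le_pq qj ltjl; set c := var_exp p in ltjl *; set e := var_exp q in qj *.
have neqjl : j != l by apply: contraTneq ltjl => ->; lia.
have eqT : (transfer c j l + transfer e l j = c + e)%MM.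
  apply/mnmP => i; rewrite !mnmDE !transferE.
  case: (eqVneq j i) => [<-|ji]; first by rewrite eq_sym (negbTE neqjl); lia.
  case: (eqVneq l i) => [<-|li]; lia.
have degT (x : 'X_{1..s}) (j1 j2 : 'I_s) :
    0 < x j2 -> mdeg x = d -> mdeg (transfer x j1 j2) = d.
  move=> xj2 <-; have := congr1 (@mdeg _) (@submK _ U_(j2) (x + U_(j1))%MM _).
  rewrite !mdegD !mdeg1 => /(_ _)/addIn; apply; apply: lepm_trans (lem_addr _ _).
  by apply/mnm_lepP => i; rewrite mnm1E; case: eqVneq => [<-|].
have [r vr] := var_exp_surj (degT c j l ltac:(lia) (mdeg_var_exp p)).
have [t vt] := var_exp_surj (degT e l j qj (mdeg_var_exp q)).
have lt_rp : Gamma_var_lt r p by rewrite Gamma_var_ltE vr transfer_lt.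
exists (U_(r) + U_(t))%MM; last by rewrite !veronese_expD !veronese_exp1 vr vt.
apply/orP; right; rewrite !mdegD !mdeg1 eqxx /=; apply/existsP.
have lt_irr := Gamma_var_lt_irr; have lt_trans := Gamma_var_lt_trans.
have lt_neq (x y : 'I_N) : Gamma_var_lt x y -> y != x.
  by move=> lt_xy; apply: contraTneq lt_xy => ->; rewrite lt_irr.
have neq_pq (x : 'I_N) : Gamma_var_lt x p -> (p != x) && (q != x).
  by move=> lt_xp; rewrite lt_neq //=; apply: contraTneq lt_xp => <-.
(* The smaller of [r] and [t] is the witness: it lies below [p] and [q], and nothing below it occurs
   in either product. *)
have [lt_tr|le_rt] := boolP (Gamma_var_lt t r).
  have lt_tp := lt_trans _ _ _ lt_tr lt_rp.
  exists t; have /andP[/negbTE pt /negbTE qt] := neq_pq t lt_tp.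
  rewrite !mnmDE !mnm1E pt qt eqxx addn1 /=; apply/forallP => x; apply/implyP => lt_xt.
  have /andP[/negbTE px /negbTE qx] := neq_pq x (lt_trans _ _ _ lt_xt lt_tp).
  have lt_xr := lt_trans _ _ _ lt_xt lt_tr.
  by rewrite !mnmDE !mnm1E px qx (negbTE (lt_neq _ _ lt_xr)) (negbTE (lt_neq _ _ lt_xt)).
exists r; have /andP[/negbTE pr /negbTE qr] := neq_pq r lt_rp.
rewrite !mnmDE !mnm1E pr qr eqxx /=; apply/forallP => x; apply/implyP => lt_xr.
have /andP[/negbTE px /negbTE qx] := neq_pq x (lt_trans _ _ _ lt_xr lt_rp).
rewrite !mnmDE !mnm1E px qx (negbTE (lt_neq _ _ lt_xr)).
by have /negbTE-> : t != x by apply: contraTneq lt_xr => <-.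
Qed.

End VeroneseMonomials.

(** * Existence of quadratic divisors *)

Section QuadraticDivisors.
Variables s d : nat.
Local Notation N := #|degree_exps s d|.
Implicit Types (m v : 'X_{1..N}) (p q r : 'I_N) (b : 'X_{1..s}).

Lemma subm1K m p : 0 < m p -> (m - U_(p) + U_(p))%MM = m.
Proof. by move=> mp; rewrite submK // lep1mP -lt0n. Qed.

Definition has_toric_quadric m :=
  exists v, [/\ (v <= m)%MM, mdeg v = 2 & toric_initial v].

(** If balance fails at [j], some factor [x_q] of the rest has a positive exponent at [j], and a
    transfer between [x_p] and [x_q] improves their product. *)
Lemma balanced_or_toric_quadric m p :
    0 < m p -> (forall q, 0 < m q -> ~~ Gamma_var_lt q p) ->
  (forall j, 0 < veronese_exp (m - U_(p)) j -> locally_balanced (var_exp p) j)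
  \/ has_toric_quadric m.
Proof.
move=> mp minp; have [/forallP bal|] :=
  boolP [forall j, (0 < veronese_exp (m - U_(p)) j) ==> locally_balanced (var_exp p) j].
  by left=> j; apply/implyP/bal.
rewrite negb_forall => /existsP[j]; rewrite negb_imply negb_forall.
move=> /andP[/veronese_exp_gt0[q mq qj] /existsP[l]]; rewrite -ltnNge => ltjl.
right; exists (U_(p) + U_(q))%MM; split; first 1 last.
- by rewrite mdegD !mdeg1.
- apply: toric_initial_transfer qj ltjl; apply: minp.
  by apply: leq_trans mq _; rewrite mnmBE leq_subr.
rewrite -[X in (_ <= X)%MM](subm1K mp) addmC.
apply/mnm_lepP => k; rewrite !mnmDE leq_add2r.
by move: k; apply/mnm_lepP; rewrite lep1mP -lt0n.
Qed.

Lemma has_toric_quadric_le m m' :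
  (m <= m')%MM -> has_toric_quadric m -> has_toric_quadric m'.
Proof. by move=> lemm [v [lev ? ?]]; exists v; split=> //; apply: lepm_trans lemm. Qed.

Lemma mnm_gt0 m : 0 < mdeg m -> exists p, 0 < m p.
Proof.
by rewrite mdegE lt0n sum_nat_eq0 negb_forall => /existsP[p]; rewrite -lt0n; exists p.
Qed.

(* Let [p] be the smallest variable of the part [m1] of [m] lying above the
   variable [i] that witnesses non-standardness. If no pair [x_p x_q] could be
   improved, [x_p] would be balanced, whereas [i < p] and [var_exp i] is
   bounded by the exponent of the image of [m1]. *)
Lemma toric_initial_quadric m :
  0 < d -> toric_initial m -> has_toric_quadric m.
Proof.
move=> d_gt0 [m' lt_mm eqv].
have eqdeg : mdeg m' = mdeg m.
  by apply/eqP; rewrite -(eqn_pmul2l d_gt0) -!mdeg_veronese_exp eqv.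
have /existsP[i /andP[lti /forallP eqi]] : [exists i, (m i < m' i) &&
    [forall j, Gamma_var_lt j i ==> (m' j == m j)]].
  by case/orP: lt_mm => [|/andP[_]//]; rewrite eqdeg ltnn.
pose m1 : 'X_{1..N} := [multinom if Gamma_var_lt i k then m k else 0 | k < N].
have le_m1m : (m1 <= m)%MM.
  by apply/mnm_lepP => k; rewrite mnmE; case: ifP.
(* On the variables not above [i], [m'] contributes at least one [var_exp i] more than [m]. As the
   images agree, the part [m1] of [m] must make up for it. *)
have le_i j : var_exp i j <= veronese_exp m1 j.
  have /mnmP/(_ j) := eqv; rewrite !veronese_expE.
  rewrite (bigID (Gamma_var_lt i)) [RHS](bigID (Gamma_var_lt i)) /=.
  have -> : \sum_p var_exp p j * m1 p = \sum_(p | Gamma_var_lt i p) var_exp p j * m p.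
    rewrite [RHS]big_mkcond; apply: eq_bigr => p _; rewrite mnmE.
    by case: ifP; rewrite ?muln0.
  have : var_exp i j + \sum_(p | ~~ Gamma_var_lt i p) var_exp p j * m p
      <= \sum_(p | ~~ Gamma_var_lt i p) var_exp p j * m' p.
    have irr : ~~ Gamma_var_lt i i by rewrite Gamma_var_lt_irr.
    rewrite !(bigD1 i irr) /= addnA -mulnS leq_add // ?leq_mul2l ?lti ?orbT //.
    apply: leq_sum => p /andP[le_pi neq_pi].
    have := Gamma_var_lt_total neq_pi; rewrite (negbTE le_pi) orbF => lt_pi.
    by have /implyP/(_ lt_pi)/eqP-> := eqi p.
  move=> le_B eq_AB; rewrite -(leq_add2r (\sum_(p | ~~ Gamma_var_lt i p) var_exp p j * m p)).
  by rewrite (leq_trans le_B) // -eq_AB leq_addl.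
have m1_gt0 : 0 < mdeg m1.
  rewrite -(ltn_pmul2l d_gt0) muln0 -mdeg_veronese_exp (@leq_trans d) //.
  by rewrite -[X in X <= _](mdeg_var_exp i) !mdegE leq_sum.
have [p0 m1p0] := mnm_gt0 m1_gt0.
have [p m1p minp] := @Gamma_var_min s d (fun k => 0 < m1 k) p0 m1p0.
have [bal|/(has_toric_quadric_le le_m1m)//] := balanced_or_toric_quadric m1p minp.
have lt_ip : Gamma_var_lt i p by move: m1p; rewrite mnmE; case: ifP.
(* Off the support of the remaining factors, [x_p] carries the whole exponent of the image of [m1],
   which bounds [var_exp i]; so optimality of [x_p] applies. *)
have := @locally_balanced_min _ _ _ (var_exp i) bal.
rewrite -Gamma_var_ltE lt_ip !mdeg_var_exp => contra.
have // : false; apply: contra => // k; rewrite -eqn0Ngt => /eqP zk; have := le_i k.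
by rewrite -{1}(subm1K m1p) veronese_expD veronese_exp1 mnmDE zk.
Qed.

Lemma quadric_above m (g : 'X_{1..s}) (a : nat) :
    (forall j : 'I_s, g j <= a) -> s * (a + 1) <= 2 * d ->
    (g <= veronese_exp m)%MM ->
  exists v, [/\ (v <= m)%MM, mdeg v <= 2 &
    toric_initial v \/ (g <= veronese_exp v)%MM].
Proof.
move=> le_ga d_large le_gm.
have quadric : has_toric_quadric m -> exists v, [/\ (v <= m)%MM, mdeg v <= 2 &
    toric_initial v \/ (g <= veronese_exp v)%MM].
  by move=> [v [lev degv iv]]; exists v; rewrite lev degv; split=> //; left.
have [small|large] := leqP (mdeg m) 2.
  by exists m; split=> //; [apply: lepm_refl | right].
have [p0 mp0] := mnm_gt0 (ltn_trans (isT : 0 < 2) large).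
have [p mp minp] := @Gamma_var_min s d (fun k => 0 < m k) p0 mp0.
pose m2 := (m - U_(p))%MM; have m2m : (m2 <= m)%MM by apply: lem_subr.
have deg_m2 : 0 < mdeg m2.
  by move: large; rewrite -(subm1K mp) mdegD mdeg1 addn1 => /ltnW.
have [q0 mq0] := mnm_gt0 deg_m2.
have [q mq minq] := @Gamma_var_min s d (fun k => 0 < m2 k) q0 mq0.
have [balp|/quadric//] := balanced_or_toric_quadric mp minp.
have [balq|quad_m2] := balanced_or_toric_quadric mq minq; last first.
  by apply: quadric; apply: has_toric_quadric_le quad_m2.
exists (U_(p) + U_(q))%MM.
have mE : m = (m2 - U_(q) + (U_(p) + U_(q)))%MM.
  by rewrite [(U_(p) + _)%MM]addmC addmA (subm1K mq) (subm1K mp).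
split; [by rewrite mE lem_addl | by rewrite mdegD !mdeg1 | right].
apply/mnm_lepP => j; rewrite veronese_expD !veronese_exp1 mnmDE.
(* Where the rest has exponent zero, [x_p x_q] has the full exponent of [m]. Elsewhere both factors
   are balanced, so [a] is at most twice each entry, hence at most their sum. *)
have [zj|pos] := posnP (veronese_exp (m2 - U_(q)) j).
  by have := mnm_lepP le_gm j; rewrite mE !veronese_expD !veronese_exp1 !mnmDE zj.
have balqj := balq j pos; have balpj : locally_balanced (var_exp p) j.
  apply: balp; rewrite -/m2 -(subm1K mq) veronese_expD mnmDE.
  by rewrite (leq_trans pos) ?leq_addr.
have := locally_balanced_half (mdeg_var_exp p) d_large balpj.
have := locally_balanced_half (mdeg_var_exp q) d_large balqj.
have := le_ga j; lia.
Qed.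

End QuadraticDivisors.

(** * Initial ideals *)

Local Open Scope ring_scope.

Section IdealTheory.
Variable A : comNzRingType.
Implicit Types (I G : A -> Prop).

Lemma ideal_gen_ideal G : is_ideal (ideal_gen G).
Proof.
split=> [|f g [r [Gr ->]] [r' [Gr' ->]]|a f [r [Gr ->]]].
- by exists [::]; rewrite big_nil.
- exists (r ++ r'); rewrite big_cat; split=> // p.
  by rewrite mem_cat => /orP[/Gr|/Gr'].
- exists [seq (a * p.1, p.2) | p <- r]; split=> [p /mapP[q qr ->]|]; first exact: (Gr q).
  by rewrite big_map big_distrr /=; apply: eq_bigr => p _; rewrite mulrA.
Qed.

Lemma mem_ideal_gen G f : G f -> ideal_gen G f.
Proof.
move=> Gf; exists [:: (1, f)]; rewrite big_seq1 mul1r; split=> // p.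
by rewrite inE => /eqP->.
Qed.

Lemma ideal_gen_min G I : is_ideal I -> (forall f, G f -> I f) ->
  forall f, ideal_gen G f -> I f.
Proof.
move=> [I0 ID IM] GI f [r [Gr ->]]; elim: r Gr => [|p r IHr] Gr.
  by rewrite big_nil.
rewrite big_cons; apply: ID; last by apply: IHr => q qr; apply: Gr; rewrite inE qr orbT.
by apply/IM/GI/Gr; rewrite inE eqxx.
Qed.
End IdealTheory.

(** * Monomial ideals and lifting of initial forms *)

Section MonomialIdealTheory.
Variables (K : fieldType) (n : nat).
Implicit Types (f g h : {mpoly K[n]}) (I : {mpoly K[n]} -> Prop).

(** Polynomials all of whose monomials are divisible by members of [M] form an ideal. *)
Lemma monomial_ideal_supp (M : 'X_{1..n} -> Prop) f m :
    ideal_gen (monomials_of M) f -> m \in msupp f ->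
  exists2 g, M g & (g <= m)%MM.
Proof.
move=> Jf; move: m; move: f Jf; apply: ideal_gen_min => [|f [g Mg ->] m].
  split=> [m|f g IHf IHg m /msuppD_le|a f IHf m /msuppM_le].
  - by rewrite msupp0.
  - by rewrite mem_cat => /orP[/IHf|/IHg].
  - move=> /allpairsP[[m1 m2] /= [_ /IHf[g Mg le_g] ->]].
    by exists g => //; apply: lepm_trans le_g (lem_addl _ _).
by move/mem_msuppXP => <-; exists g => //; apply: lepm_refl.
Qed.

Lemma mem_monomial_ideal (M : 'X_{1..n} -> Prop) (g m : 'X_{1..n}) :
  M g -> (g <= m)%MM -> ideal_gen (monomials_of M) ('X_[m] : {mpoly K[n]}).
Proof.
move=> Mg le_gm; rewrite -(submK le_gm) mpolyXD.
by apply: (ideal_mul (ideal_gen_ideal _)); apply: mem_ideal_gen; exists g.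
Qed.

Lemma mcoeff_pihomog (mf : measure n) k f m :
  (pihomog mf k f)@_m = if mf m == k then f@_m else 0.
Proof.
rewrite pihomogE raddf_sum /= big_mkcond.
have termE m' : (if mf m' == k then (f@_m' *: 'X_[m'])@_m else 0) =
    if mf m == k then (f@_m' *: 'X_[m'])@_m else 0.
  rewrite mcoeffZ mcoeffX; case: (eqVneq m' m) => [->|_]; first by [].
  by rewrite mulr0 !if_same.
rewrite (eq_bigr _ (fun m' _ => termE m')) [in RHS](mpolyE f) raddf_sum /=.
by case: ifP => // _; rewrite big1.
Qed.

Lemma mcoeffMXE f e m :
  (f * 'X_[e])@_m = if (e <= m)%MM then f@_(m - e) else 0.
Proof.
case: ifP => [le_em|nle_em]; first by rewrite -{1}(submK le_em) addmC mcoeffMX.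
apply/eqP; rewrite mcoeff_eq0 (perm_mem (msuppMX _ _)); apply: contraFN nle_em.
by move=> /mapP[m' _ ->]; apply: lem_addr.
Qed.

Variable w : 'I_n -> nat.

(** Each nonzero weight component of an element of in_w(I) is itself an initial form. The property
    is required for all [k] at once because multiplication by a monomial shifts [k]; so stated, it
    defines an ideal containing the initial forms. *)
Lemma weight_initial_ideal_lift I g : is_ideal I -> weight_initial_ideal w I g ->
  forall k, exists2 h, I h &
    forall m, (k <= wdeg w m)%N -> h@_m = if wdeg w m == k then g@_m else 0.
Proof.
move=> [I0 ID IM]; move: g; apply: ideal_gen_min => [|g [f If ->] k]; last first.
  have [->|neq_k] := eqVneq k (mmeasure (wdeg w) f).-1.
    exists f => // m le_m; rewrite mcoeff_pihomog; case: eqP => // neq_m.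
    apply/eqP; rewrite mcoeff_eq0; apply: (mmeasure_mnm_ge (mf := wdeg w)).
    by move: neq_m le_m => /=; lia.
  exists 0 => // m _; rewrite mcoeff0 mcoeff_pihomog; case: (wdeg w m =P k) => //= ->.
  by rewrite (negbTE neq_k).
have QD f g : (forall k, exists2 h, I h & forall m, (k <= wdeg w m)%N ->
      h@_m = if wdeg w m == k then f@_m else 0) ->
    (forall k, exists2 h, I h & forall m, (k <= wdeg w m)%N ->
      h@_m = if wdeg w m == k then g@_m else 0) ->
    (forall k, exists2 h, I h & forall m, (k <= wdeg w m)%N ->
      h@_m = if wdeg w m == k then (f + g)@_m else 0).
  move=> Qf Qg k; have [hf If Ef] := Qf k; have [hg Ig Eg] := Qg k.
  exists (hf + hg) => [|m le_m]; first exact: ID.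
  by rewrite mcoeffD Ef // Eg //; case: ifP; rewrite ?mcoeffD ?addr0.
split=> // [k|a f Qf].
  by exists 0 => // m _; rewrite mcoeff0 if_same.
elim/mpolyind: a => [|c e a _ _ IHa].
  by move=> k; exists 0 => // m _; rewrite mul0r mcoeff0 if_same.
rewrite mulrDl; apply: QD => // k; have [le_ek|lt_ke] := leqP (wdeg w e) k; last first.
  exists 0 => // m _; rewrite mcoeff0; case: eqP => // wm.
  rewrite -scalerAl mcoeffZ [_ * f]mulrC mcoeffMXE.
  case: ifP => [le_em|_]; last by rewrite mulr0.
  by move: lt_ke; rewrite -wm -(submK le_em) wdegD ltnNge leq_addl.
have [h Ih Eh] := Qf (k - wdeg w e)%N.
exists (c *: 'X_[e] * h) => [|m le_m]; first exact: IM.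
rewrite -!scalerAl !mcoeffZ [_ * h]mulrC [_ * f]mulrC !mcoeffMXE.
case: ifP => [le_em|_]; last by rewrite mulr0 if_same.
have wE : (wdeg w m = wdeg w (m - e) + wdeg w e)%N by rewrite -wdegD submK.
rewrite Eh; last by move: le_m; rewrite wE; lia.
have -> : (wdeg w (m - e)%MM == (k - wdeg w e)%N) = (wdeg w m == k).
  by rewrite wE; apply/eqP/eqP; lia.
by case: ifP; rewrite ?mulr0.
Qed.
End MonomialIdealTheory.

(** * The initial ideal of the preimage *)

Section VeroneseInitial.
Variables (K : fieldType) (s d : nat) (w : 'I_s -> nat).
Variable I : {mpoly K[s]} -> Prop.
Local Notation N := #|degree_exps s d|.
Local Notation J := (fun f : {mpoly K[N]} => I (veronese_map f)).
Local Notation lt := (@Gamma_weight_lt s d w).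
Implicit Types (f : {mpoly K[N]}) (m v : 'X_{1..N}).

Lemma veronese_mapX m : veronese_map 'X_[K, m] = 'X_[veronese_exp m].
Proof.
rewrite /veronese_map comp_mpolyX /veronese_exp -mprodXnE.
by apply: eq_bigr => i _; rewrite tnth_mktuple.
Qed.

Lemma mcoeff_veronese_map f b : (veronese_map f)@_b =
  \sum_(m <- msupp f | veronese_exp m == b) f@_m.
Proof.
rewrite /veronese_map comp_mpolyEX raddf_sum [RHS]big_mkcond /=.
apply: eq_bigr => m _; rewrite mcoeffZ -/(veronese_map _) veronese_mapX mcoeffX.
by case: eqP; rewrite ?mulr1 ?mulr0.
Qed.

Lemma mem_initial_ideal f v :
    J f -> f@_v = 1 ->
    (forall m, m \in msupp f -> m != v -> lt m v) ->
  initial_ideal lt J 'X_[v].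
Proof.
move=> Jf fv lt_v; apply: mem_ideal_gen; exists f => //; exists v; split=> //.
  by rewrite mcoeff_msupp fv oner_eq0.
by rewrite fv scale1r.
Qed.

Lemma toric_initial_mem v :
  is_ideal I -> toric_initial v -> initial_ideal lt J 'X_[v].
Proof.
move=> [I0 _ _] [v' lt_v eq_v].
have neq_v : v' != v.
  apply: contraTneq lt_v => ->; apply/norP; rewrite ltnn eqxx; split=> //=.
  by apply/existsP => -[i]; rewrite ltnn.
apply: (@mem_initial_ideal ('X_[v] - 'X_[v'])) => [||m].
- by rewrite /veronese_map comp_mpolyB -!/(veronese_map _) !veronese_mapX eq_v subrr.
- by rewrite mcoeffB !mcoeffX eqxx (negbTE neq_v) subr0.
move/msuppB_le; rewrite mem_cat !msuppX !inE => /orP[->//|/eqP-> _].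
by apply/orP; right; rewrite !wdeg_veronese_exp eq_v eqxx.
Qed.

(** An element of [I] with initial form y^b is cut down to degree [mdeg b = d * mdeg v], where every
    monomial has a preimage, and lifted term by term; weights are preserved, so [v] leads. *)
Lemma initial_ideal_lift v : (0 < d)%N -> homogeneous_ideal I ->
  weight_initial_ideal w I 'X_[veronese_exp v] -> initial_ideal lt J 'X_[v].
Proof.
move=> d_gt0 [I_ideal I_pihomog]; set b := veronese_exp v.
move=> /(weight_initial_ideal_lift I_ideal)/(_ (wdeg w b))[h0 Ih0 Eh0].
pose h := pihomog mdeg (mdeg b) h0.
have Ih : I h by apply: I_pihomog.
have hb : h@_b = 1 by rewrite mcoeff_pihomog /= eqxx Eh0 // eqxx mcoeffX eqxx.
have h_supp c : c \in msupp h -> mdeg c = mdeg b /\ (c != b -> wdeg w c < wdeg w b)%N.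
  rewrite mcoeff_msupp mcoeff_pihomog /=.
  case: (eqVneq (mdeg c)) => [degc|]; last by rewrite eqxx.
  move=> h0c; split=> // neq_cb; rewrite ltnNge; apply: contraNN h0c => le_bc.
  by rewrite Eh0 // mcoeffX [b == c]eq_sym (negbTE neq_cb) if_same.
(* Preimages of monomials of [h] have degree [mdeg v], so the search is finite; the default 0 is not
   reached on the support of [h]. *)
pose lift c := if [pick m : 'X_{1..N < (mdeg v).+1} | veronese_exp m == c] is Some m
  then bmnm m else 0%MM.
have liftK c : c \in msupp h -> veronese_exp (lift c) = c.
  case/h_supp => degc _; rewrite /lift; case: pickP => [m /eqP//|none].
  have [m vm] : exists m : 'X_{1..N}, veronese_exp m = c.
    by apply: (@veronese_exp_surj s d (mdeg v)); rewrite degc mdeg_veronese_exp.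
  have ltm : (mdeg m < (mdeg v).+1)%N.
    rewrite ltnS -(leq_pmul2l d_gt0) -!mdeg_veronese_exp vm degc.
    exact: leqnn.
  by have := none (BMultinom ltm); rewrite /= vm eqxx.
(* The term y^b is lifted to [v], which may differ from [lift b]. *)
pose f := 'X_[v] + \sum_(c <- msupp h | c != b) h@_c *: 'X_[lift c].
have lift_v c : c \in msupp h -> c != b -> lift c != v.
  by move=> ch; apply: contraNneq => eq_v; rewrite -(liftK c ch) eq_v.
have f_supp m : m \in msupp f -> m != v ->
    exists c, [/\ c \in msupp h, c != b & m = lift c].
  move/msuppD_le; rewrite mem_cat msuppX inE => /orP[->//|/msupp_sum_le].
  move=> /flattenP[x /mapP[c]]; rewrite mem_filter => /andP[cb ch] ->.
  by move/msuppZ_le; rewrite msuppX inE => /eqP ->; exists c.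
apply: (@mem_initial_ideal f) => [||m mf neq_mv].
- suff -> : veronese_map f = h by [].
  rewrite [RHS]mpolyE (bigD1_seq b) ?msupp_uniq //=; last by rewrite mcoeff_msupp hb oner_eq0.
  rewrite hb scale1r /veronese_map /f comp_mpolyD -!/(veronese_map _) veronese_mapX.
  congr (_ + _); rewrite /veronese_map raddf_sum big_seq_cond [RHS]big_seq_cond.
  apply: eq_bigr => c /andP[ch _].
  by rewrite /= comp_mpolyZ -/(veronese_map _) veronese_mapX liftK.
- rewrite mcoeffD mcoeffX eqxx raddf_sum big_seq_cond big1 ?addr0 // => c /andP[ch cb].
  by rewrite /= mcoeffZ mcoeffX (negbTE (lift_v c ch cb)) mulr0.
have [c [ch cb ->]] := f_supp m mf neq_mv.
by apply/orP; left; rewrite !wdeg_veronese_exp liftK //; apply: (h_supp c ch).2.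
Qed.

(** If y^b cancels in the image of [f], another monomial of [f] lies in the fibre of [m]; its weight
    is the same, so it is smaller by the tie-breaker. Otherwise y^b survives, and has top weight
    because [m] has top weight in [f]. *)
Lemma initial_term_cases f m :
    J f -> m \in msupp f -> (forall m', m' \in msupp f -> m' != m -> lt m' m) ->
  toric_initial m \/ exists2 F, weight_initial_ideal w I F & veronese_exp m \in msupp F.
Proof.
move=> Jf mf lt_m; pose b := veronese_exp m; pose F := veronese_map f.
have [zFb|nzFb] := eqVneq F@_b 0.
  left; have [/hasP[m' m'f /andP[neq_m /eqP eq_b]]|/hasPn none] :=
    boolP (has (fun m' => (m' != m) && (veronese_exp m' == b)) (msupp f)).
    exists m' => //; have /orP[|/andP[]//] := lt_m m' m'f neq_m.
    by rewrite !wdeg_veronese_exp eq_b ltnn.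
  move: zFb; rewrite /F mcoeff_veronese_map big_mkcond (bigD1_seq m) ?msupp_uniq //= eqxx.
  rewrite big1_seq => [|m' /andP[neq_m /none]]; last by rewrite neq_m /= => /negbTE->.
  by move/eqP; rewrite addr0 mcoeff_eq0 mf.
right; exists (weight_initial_form w F); first by apply: mem_ideal_gen; exists F.
rewrite mcoeff_msupp /weight_initial_form mcoeff_pihomog /=.
suff -> : wdeg w b == (mmeasure (wdeg w) F).-1 by [].
have bF : b \in msupp F by rewrite mcoeff_msupp.
have ub : (mmeasure (wdeg w) F <= (wdeg w b).+1)%N.
  rewrite mmeasureE big_seq; apply/bigmax_leqP_seq => c cF _ /=.
  have [/hasP[m' m'f /eqP<-]|/hasPn none] :=
    boolP (has (fun m' => veronese_exp m' == c) (msupp f)).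
    rewrite ltnS -!wdeg_veronese_exp; have [->//|neq_m] := eqVneq m' m.
    by have /orP[/ltnW|/andP[/eqP->]] := lt_m m' m'f neq_m.
  move: cF; rewrite mcoeff_msupp mcoeff_veronese_map big_seq_cond big1 ?eqxx // => m'.
  by move=> /andP[/none/negbTE->].
have lb : (wdeg w b < mmeasure (wdeg w) F)%N.
  exact: (@mmeasure_mnm_lt _ _ (wdeg w)) bF.
by apply/eqP; move: lb ub; case: (mmeasure _ _) => //= k; lia.
Qed.

End VeroneseInitial.

Theorem theorem3p14 (K : fieldType) (s d : nat) (d_gt0 : (0 < d)%N)
    (I : {mpoly K[s]} -> Prop) (I_homog : homogeneous_ideal I)
    (w : 'I_s -> nat) (inI_mono : monomial_ideal (weight_initial_ideal w I))
    (G : seq 'X_{1..s})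
    (G_min : minimal_monomial_generators (weight_initial_ideal w I) G)
    (a : nat) (a_def : a = (\max_(m <- G) \max_(j < s) m j)%N)
    (d_large : (s * (a + 1) <= 2 * d)%N) :
  generated_by_quadratic_monomials
    (initial_ideal (@Gamma_weight_lt s d w)
       (fun f : {mpoly K[#|degree_exps s d|]} => I (veronese_map f))).
Proof.
case: G_min => _ inI_G _; set in_J := initial_ideal _ _.
(* The generators are all monomials of degree at most two in the initial ideal; it remains to find
   one dividing each initial monomial. *)
exists (fun v => (mdeg v <= 2)%N /\ in_J 'X_[v]); split=> [v []//|f]; split; last first.
  apply: ideal_gen_min; first exact: ideal_gen_ideal.
  by move=> g [v [_ in_v] ->].
apply: ideal_gen_min; first exact: ideal_gen_ideal.
move=> _ [{}f Jf [m [mf lt_m ->]]].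
suff [v [lev degv in_v]] : exists v, [/\ (v <= m)%MM, (mdeg v <= 2)%N & in_J 'X_[v]].
  rewrite -mul_mpolyC; apply: (ideal_mul (ideal_gen_ideal _)).
  exact: mem_monomial_ideal lev.
have [/(toric_initial_quadric d_gt0)[v [lev degv tor_v]]|[F inF mF]] :=
  initial_term_cases Jf mf lt_m.
  by exists v; rewrite lev degv; split=> //; apply: toric_initial_mem (proj1 I_homog) tor_v.
have [g gG le_g] := monomial_ideal_supp (proj1 (inI_G F) inF) mF.
have le_ga j : (g j <= a)%N.
  apply: leq_trans (leq_bigmax j) _; rewrite a_def.
  exact: (leq_bigmax_seq (F := fun m : 'X_{1..s} => \max_(j < s) m j)%N).
have [v [lev degv [tor_v|le_gv]]] := quadric_above le_ga d_large le_g.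
  by exists v; split=> //; apply: toric_initial_mem (proj1 I_homog) tor_v.
exists v; split=> //; apply: initial_ideal_lift => //; apply/inI_G.
exact: mem_monomial_ideal le_gv.
Qed.
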